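(* Let $\tau$ be an infinite regular cardinal, and let $X$ be a $T_1$ locally openly Lindelöf$_\tau$ space with $odL(X)\le\tau$. Then either $L(X)\le\tau$, or there is a clopen subset of $X$ of cardinality $\ge\tau$ which is discrete in the subspace topology.
   Context: For a topological space $X$: $L(X)$ is the smallest cardinal $\kappa$ such that every open cover of $X$ has a subcover of cardinality $<\kappa$; $odL(X)$ is the smallest cardinal $\kappa$ such that every cover of $X$ by open dense subsets of $X$ has a subcover of cardinality $<\kappa$. A space (or subspace) $Y$ is Lindelöf$_\tau$ if $L(Y)\le\tau$. $X$ is locally openly Lindelöf$_\tau$ if each point of $X$ has an open neighborhood which is Lindelöf$_\tau$ (as a subspace). *)

(* Defs.v *)
From mathcomp Require Import all_boot all_order.
From mathcomp Require Import all_classical topology.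

Set Implicit Arguments.
Unset Strict Implicit.
Unset Printing Implicit Defensive.

Local Open Scope classical_set_scope.
Local Open Scope card_scope.

(* A cardinal is represented by a type, standing for its equipotence class:
   the order on cardinals is [set: K] #<= [set: K']. *)

Definition card_lt (T U : Type) (A : set T) (B : set U) : Prop :=
  A #<= B /\ A #!= B.

Definition least_cardinal (P : Type -> Prop) (K : Type) : Prop :=
  P K /\ forall K' : Type, P K' -> [set: K] #<= [set: K'].

(* An initial ordinal: a well-order all of whose proper initial segments have
   strictly smaller cardinality than the whole. *)
Definition initial_well_order (T : Type) (R : rel T) : Prop :=
  wochoice.well_order R /\
  forall x : T, card_lt [set y | R y x /\ y <> x] [set: T].

Definition cofinal (T : Type) (R : rel T) (A : set T) : Prop :=
  forall x : T, exists2 y : T, A y & R x y.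

Definition is_cofinality (T : Type) (R : rel T) (K : Type) : Prop :=
  least_cardinal
    (fun K' : Type => exists2 A : set T, cofinal R A & A #= [set: K']) K.

(* cf(tau) = tau. The choice of R is immaterial: any two initial well-orders
   on the same type are isomorphic. *)
Definition infinite_regular (T : Type) : Prop :=
  infinite_set [set: T] /\
  exists2 R : rel T, initial_well_order R & is_cofinality R T.

Section covering_numbers.
Variable X : topologicalType.
Implicit Types (P : set (set X)) (C D : set (set X)) (K : Type).

Definition covers C : Prop := cover C id = [set: X].

(* Every cover of X by members of P has a subcover of cardinality < K. *)
Definition covering_property P K : Prop :=
  forall C, C `<=` P -> covers C ->
    exists D, [/\ D `<=` C, covers D & card_lt D [set: K]].

Definition is_L K : Prop :=
  least_cardinal (covering_property [set U | open U]) K.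

Definition is_odL K : Prop :=
  least_cardinal (covering_property [set U | open U /\ dense U]) K.

Definition L_le K : Prop := exists2 K', is_L K' & [set: K'] #<= [set: K].

Definition odL_le K : Prop := exists2 K', is_odL K' & [set: K'] #<= [set: K].

End covering_numbers.

(* For U : set X, the type set_type U carries the subspace topology. *)
Definition locally_openly_lindelof (X : topologicalType) (K : Type) : Prop :=
  forall x : X, exists U : set X, [/\ open U, U x & L_le (set_type U) K].

Definition discrete_subspace (X : topologicalType) (D : set X) : Prop :=
  forall A : set (set_type D), open A.

(* Main.v *)
Require Import Defs.
From mathcomp Require Import all_boot all_order.
From mathcomp Require Import all_classical topology.

(* Call A small if #|A| < tau. If F is closed and nowhere dense, then
   O `|` ~` F is open and dense for every open O, so odL(X) <= tau makes F
   Lindelof_tau. Take a maximal disjoint family V of open sets, each inside an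
   open Lindelof_tau set. Its union is dense, so the complement lies in a union W
   of a small family of open Lindelof_tau sets. The sets A `\` W, for A in V, form
   a discrete family of closed sets; a choice of one nonisolated point in as many
   of them as possible is a closed nowhere dense discrete set, hence small. So, W
   together with a small family of open Lindelof_tau sets leaves out only isolated
   points. What is left out is clopen and discrete, and if it is small then X is
   covered by a small family of Lindelof_tau sets. *)

Set Implicit Arguments.
Unset Strict Implicit.
Unset Printing Implicit Defensive.

Local Open Scope classical_set_scope.
Local Open Scope card_scope.

(** * Comparison of cardinals *)

(* Honig: a maximal set of choice functions, pairwise distinct at every index,
   exhausts some A i, which therefore embeds into all the others. *)
Lemma exists_least_card (I : Type) (T : I -> Type) (A : forall i, set (T i)) :
  I -> exists i, forall j, A i #<= A j.
Proof.
move=> i0.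
pose P (S : set (forall i, T i)) :=
  (forall f i, S f -> A i (f i)) /\
  (forall f g i, S f -> S g -> f i = g i -> f = g).
have [F FP Ftot|S [[SA Sinj] Smax]] := @Zorn_bigcup _ P.
  split=> [f i [S FS Sf]|f g i [S FS Sf] [S' FS' S'g]].
    exact: (FP _ FS).1.
  by case: (Ftot _ _ FS FS') => sub; [apply: (FP _ FS').2|apply: (FP _ FS).2] => //;
    exact: sub.
have [i Ai] : exists i, A i `<=` (fun f => f i) @` S.
  apply: contrapT => noi.
  have next i : exists a, A i a /\ ~ ((fun f => f i) @` S) a.
    apply: contrapT => noa; apply: noi; exists i => a Aa.
    by apply: contrapT => na; apply: noa; exists a.
  pose h i := sval (cid (next i)).
  have hA i : A i (h i) by exact: (svalP (cid (next i))).1.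
  have hS i f : S f -> f i <> h i.
    by move=> Sf fh; apply: (svalP (cid (next i))).2; exists f.
  apply: (Smax (S `|` [set h])).
    split=> [f Sf|]; first by left.
    (* At the index [i0], [h] differs from every member of [S], so it is new. *)
    by move=> /(_ h (or_intror erefl)) Sh; exact: (hS i0 h Sh erefl).
  split=> [f i [/SA//|->//]|f g i [Sf|->] [Sg|->]//].
  - exact: Sinj.
  - by move=> fg; case: (hS i f Sf fg).
  - by move=> fg; case: (hS i g Sg (esym fg)).
exists i => j; apply: (card_le_trans (subset_card_le Ai)).
apply: (card_le_trans (card_image_le _ _)).
have /card_eqPle[_] : (fun f => f j) @` S #= S.
  by apply: inj_card_eq => f g /set_mem Sf /set_mem Sg; exact: Sinj.
move=> /card_le_trans; apply.
by apply: subset_card_le => _ [f Sf <-]; exact: SA.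
Qed.

Lemma card_le_total (T U : Type) (A : set T) (B : set U) :
  A #<= B \/ B #<= A.
Proof.
pose F (b : bool) : set (if b then T else U) :=
  if b return set (if b then T else U) then A else B.
have [[] h] := @exists_least_card bool _ F true.
- by left; exact: (h false).
- by right; exact: (h true).
Qed.

(* Minimizing over the subsets of K only keeps the index type of
   [exists_least_card] in the universe of [set K]. *)
Lemma least_cardinal_exists (P : Type -> Prop) (K : Type) :
  (forall K1 K2 : Type, P K1 -> [set: K1] #<= [set: K2] -> P K2) ->
  P K -> exists2 K', least_cardinal P K' & [set: K'] #<= [set: K].
Proof.
move=> Pmono PK; have /card_eqPle[TK KT] := card_setT [set: K].
have [[A PA] Amin] := @exists_least_card {A : set K | P (set_type A)}
  (fun=> K) (fun A => sval A) (exist _ [set: K] (Pmono _ _ PK KT)).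
have /card_eqPle[TA AT] := card_setT A.
exists (set_type A); last exact: card_le_trans TA (card_leT _).
(* A smaller [K'] is equipotent to a subset of [K], which competes in the minimum. *)
split=> // K' PK'; case: (card_le_total [set: set_type A] [set: K']) => // K'A.
have /card_subP[B /card_eqPle[BK' K'B] BA] := card_le_trans K'A TA.
have /card_eqPle[TB BT] := card_setT B.
have PB : P (set_type B) := Pmono _ _ PK' (card_le_trans K'B BT).
exact: card_le_trans TA (card_le_trans (Amin (exist _ B PB)) BK').
Qed.

Lemma card_ltNge (T U : Type) (A : set T) (B : set U) :
  card_lt A B <-> ~ (B #<= A).
Proof.
split=> [[AB /negP nAB] BA|nBA].
  by apply: nAB; rewrite card_eq_le AB BA.
split; first by case: (card_le_total A B).
by apply/negP => /card_eqPle[].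
Qed.

Lemma card_le_lt_trans (T U V : Type) (A : set T) (B : set U) (C : set V) :
  A #<= B -> card_lt B C -> card_lt A C.
Proof.
by move=> AB /card_ltNge nCB; apply/card_ltNge => CA; exact/nCB/(card_le_trans CA).
Qed.

Lemma card_lt_le_trans (T U V : Type) (A : set T) (B : set U) (C : set V) :
  card_lt A B -> B #<= C -> card_lt A C.
Proof.
by move=> /card_ltNge nBA BC; apply/card_ltNge => CA; exact/nBA/(card_le_trans BC).
Qed.

Lemma card_lt_finite (T U : Type) (A : set T) (B : set U) :
  finite_set A -> infinite_set B -> card_lt A B.
Proof. by move=> fA iB; apply/card_ltNge => /card_le_finite/(_ fA). Qed.

Lemma card_le_inj (K U : Type) (B : set U) :
  [set: K] #<= B -> exists2 f : K -> U, injective f & forall k, B (f k).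
Proof.
move=> /card_leP[f]; exists (fun k => val (f (to_setT k))).
  by move=> k k' /val_inj/(inj); rewrite !inE => /(_ I I) /(congr1 val).
by move=> k; exact/set_mem/valP.
Qed.

(** Turns a small subcover by traces or enlargements of open sets back into a small family of the
    original sets. *)
Lemma image_section (T U : Type) (f : T -> U) (C : set T) (D : set U) :
  D `<=` f @` C -> exists E, [/\ E `<=` C, f @` E = D & E #<= D].
Proof.
move=> DC; have [->|/set0P[y0 /DC[x0 _ _]]] := eqVneq D set0.
  by exists set0; rewrite image_set0; split => //; exact: card_lexx.
have /choice[g gP] : forall y, exists x, D y -> C x /\ f x = y.
  move=> y; have [/DC[x Cx <-]|nDy] := pselect (D y).
    by exists x.
  by exists x0.
exists (g @` D); split; last exact: card_image_le.
- by move=> _ [y Dy <-]; exact: (gP y Dy).1.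
- rewrite eqEsubset; split=> [_ [_ [y Dy <-] <-]|y Dy].
    by rewrite (gP y Dy).2.
  by exists (g y); [exists y|exact: (gP y Dy).2].
Qed.

(** The least element of the pair {x, y} is below both. *)
Lemma well_order_total (T : Type) (R : rel T) :
  wochoice.well_order R -> total R.
Proof.
move=> Rwo x y.
have [|z [[/asboolP zxy zmin] _]] := Rwo (fun z => `[< z = x \/ z = y >]).
  by exists x; apply/asboolP; left.
have Rzx : R z x by apply: zmin; apply/asboolP; left.
have Rzy : R z y by apply: zmin; apply/asboolP; right.
by case: zxy => zE; rewrite zE in Rzx Rzy; rewrite ?Rzx ?Rzy ?orbT.
Qed.

(** * Small unions of small sets *)

Section regular.
Variable tau : Type.
Hypothesis tau_reg : infinite_regular tau.

(* An injection of tau into the union splits tau into fewer than tau fibres,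
   each of size < tau, hence each strictly bounded; so are the bounds. *)
Lemma regular_bigcup (I T : Type) (D : set I) (F : I -> set T) :
  card_lt D [set: tau] -> (forall i, D i -> card_lt (F i) [set: tau]) ->
  card_lt (\bigcup_(i in D) F i) [set: tau].
Proof.
case: tau_reg => _ [R [Rwo _] [_ cof]] Dlt Flt.
have Rtot := well_order_total Rwo.
(* A small set is not cofinal, because the cofinality is [tau]; a witness of this lies strictly
   above the whole set. *)
have bounded (A : set tau) : card_lt A [set: tau] ->
    exists s, forall t, A t -> ~~ R s t.
  move=> /card_ltNge Alt; apply: contrapT => nob; apply: Alt.
  have /card_eqPle[AA _] := card_setT A; apply: card_le_trans AA.
  apply: cof; exists A; last exact: card_setT_sym.
  move=> x; apply: contrapT => nox; apply: nob; exists x => t At.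
  by apply/negP => Rxt; apply: nox; exists t.
apply/card_ltNge => /card_le_inj[f finj fF].
have /choice[g gP] : forall t, exists i, D i /\ F i (f t).
  by move=> t; case: (fF t) => i Di Fi; exists i.
have /choice[s sP] : forall i, exists s, D i -> forall t, g t = i -> ~~ R s t.
  (* [t0] is a default value for indices outside [D]. *)
  have [t0 _] := bounded set0 (card_lt_finite (finite_set0 _) tau_reg.1).
  move=> i; have [Di|nDi] := pselect (D i); last by exists t0.
  have [|s sP] := bounded (g @^-1` [set i]); last by exists s.
  apply: card_le_lt_trans (Flt i Di).
  have /card_eqPle[_] := inj_card_eq (A := g @^-1` [set i]) (in2W finj).
  move=> /card_le_trans; apply.
  by apply: subset_card_le => _ [t <- <-]; exact: (gP t).2.
have [|r rP] := bounded (s @` D).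
  by apply: card_le_lt_trans Dlt; exact: card_image_le.
(* [r] lies strictly above all fibre bounds, yet strictly below the bound of its own fibre; totality
   forbids this. *)
have Dr := (gP r).1.
have := rP _ (imageP s Dr); have := sP _ Dr _ erefl.
by case/orP: (Rtot r (s (g r))) => ->.
Qed.

Lemma regular_setU (T : Type) (A B : set T) :
  card_lt A [set: tau] -> card_lt B [set: tau] -> card_lt (A `|` B) [set: tau].
Proof.
move=> Alt Blt; rewrite -bigcup2E; apply: (@card_le_lt_trans _ _ _ _
  (\bigcup_(b in [set: bool]) if b then A else B)).
  apply: subset_card_le => x [[|[|n]] _ //= Ax]; by [exists true|exists false].
apply: regular_bigcup => [|[]//].
exact: card_lt_finite (@finite_finset _ _) tau_reg.1.
Qed.

End regular.

(** * Covering properties and relative Lindelöf sets *)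

Section covering.
Variable X : topologicalType.

Lemma covering_property_mono (P : set (set X)) (K1 K2 : Type) :
  covering_property P K1 -> [set: K1] #<= [set: K2] -> covering_property P K2.
Proof.
move=> PK K12 C CP Ccov; have [D [DC Dcov Dlt]] := PK C CP Ccov.
by exists D; split => //; exact: card_lt_le_trans K12.
Qed.

(** The covering property passes to larger cardinals, so once it holds at [K] a least cardinal
    exists below [K]. *)
Lemma L_leP (K : Type) :
  L_le X K <-> covering_property [set U : set X | open U] K.
Proof.
split=> [[K' [cK' _] K'K]|]; first exact: covering_property_mono K'K.
by apply: least_cardinal_exists => K1 K2; exact: covering_property_mono.
Qed.

End covering.

Section lindelof_in.
Variables (X : topologicalType) (tau : Type).

(** Covers consist of open sets of [X], so that unions of such sets can be treated without changing
    the space. *)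
Definition lindelof_in (A : set X) := forall C : set (set X),
  C `<=` open -> A `<=` \bigcup_(U in C) U ->
  exists D, [/\ D `<=` C, A `<=` \bigcup_(U in D) U & card_lt D [set: tau]].

Lemma lindelof_in_subspace (A : set X) :
  L_le (set_type A) tau -> lindelof_in A.
Proof.
move=> [K' [cK' _] K'K] C Cop AC.
pose r (O : set X) : set (set_type A) := set_val @^-1` O.
have [||D' [D'C D'cov D'lt]] := covering_property_mono cK' K'K (C := r @` C).
- by move=> _ [O CO <-]; exists O => //; exact: Cop.
- rewrite /covers /cover -subTset => x _.
  by have [O CO Ox] := AC _ (set_valP x); exists (r O) => //; exists O.
have [D [DC DD' leD]] := image_section D'C.
exists D; split => //; last exact: card_le_lt_trans leD D'lt.
move=> x Ax; have : covers D' by []; rewrite /covers -subTset.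
move=> /(_ (exist _ x (mem_set Ax)) I) [O' /=]; rewrite -DD' => -[O DO <-] Ox.
by exists O.
Qed.

Hypothesis tau_reg : infinite_regular tau.

Lemma lindelof_in_bigcup (I : Type) (D : set I) (F : I -> set X) :
  card_lt D [set: tau] -> (forall i, D i -> lindelof_in (F i)) ->
  lindelof_in (\bigcup_(i in D) F i).
Proof.
move=> Dlt Flind C Cop FC.
have /choice[E EP] : forall i, exists E, D i ->
    [/\ E `<=` C, F i `<=` \bigcup_(U in E) U & card_lt E [set: tau]].
  move=> i; have [Di|nDi] := pselect (D i); last by exists set0.
  have [|E Eh] := Flind i Di C Cop; last by exists E.
  by move=> x Fx; apply: FC; exists i.
exists (\bigcup_(i in D) E i); split.
- by move=> U [i Di EU]; have [+ _ _] := EP i Di; exact.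
- move=> x [i Di Fx]; have [_ /(_ _ Fx)[U EU Ux] _] := EP i Di.
  by exists U => //; exists i.
- by apply: regular_bigcup => // i Di; case: (EP i Di).
Qed.

Hypothesis od : covering_property [set U : set X | open U /\ dense U] tau.

Lemma lindelof_in_closed_nowhere_dense (F : set X) :
  closed F -> dense (~` F) -> lindelof_in F.
Proof.
move=> cF dF C Cop FC.
(* A point of [F] makes [C] nonempty; otherwise no enlarged set would be there to cover the
   complement of [F]. *)
have [F0|/set0P[x0 Fx0]] := eqVneq F set0.
  exists set0; split => //; first by rewrite F0.
  exact: card_lt_finite tau_reg.1.
have oF : open (~` F) by rewrite openC.
have [||D' [D'C D'cov D'lt]] := od (C := (fun O => O `|` ~` F) @` C).
- move=> _ [O CO <-]; split; first by apply: openU => //; exact: Cop.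
  by move=> W W0 oW; have [x [Wx Fx]] := dF W W0 oW; exists x; split => //; right.
- rewrite /covers /cover -subTset => x _.
  have [Fx|nFx] := pselect (F x).
    by have [O CO Ox] := FC _ Fx; exists (O `|` ~` F); [exists O|left].
  by have [O CO _] := FC _ Fx0; exists (O `|` ~` F); [exists O|right].
have [D [DC DD' leD]] := image_section D'C.
exists D; split => //; last exact: card_le_lt_trans leD D'lt.
move=> x Fx; have : covers D' by []; rewrite /covers -subTset.
move=> /(_ x I) [O' /=]; rewrite -DD' => -[O DO <-] [Ox|//].
by exists O.
Qed.

End lindelof_in.

(** * Isolated points and disjoint open families *)

Lemma open_isolated_points (X : topologicalType) (A : set X) :
  (forall x, A x -> open [set x]) -> open A.
Proof.
move=> Aiso; have -> : A = \bigcup_(x in A) [set x].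
  by rewrite eqEsubset; split => [x Ax|x [_ ? ->]//]; exists x.
exact: bigcup_open.
Qed.

Lemma discrete_subspace_isolated_points (X : topologicalType) (A : set X) :
  (forall x, A x -> open [set x]) -> discrete_subspace A.
Proof.
move=> Aiso B; exists (set_val @` B).
  by apply: open_isolated_points => _ [x _ <-]; exact/Aiso/set_valP.
by rewrite eqEsubset; split => [x [y By /val_inj <-]//|x Bx]; exists x.
Qed.

(** By Zorn: if a nonempty open set missed the union, its intersection with a neighborhood from [Q]
    could be added. *)
Lemma maximal_disjoint_open_refinement (X : topologicalType)
    (Q : set (set X)) :
  (forall x : X, exists U, [/\ open U, U x & Q U]) ->
  exists V : set (set X),
    [/\ V `<=` open, forall A, V A -> exists2 U, Q U & A `<=` U,
        (forall A B x, V A -> V B -> A x -> B x -> A = B) &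
        dense (\bigcup_(A in V) A)].
Proof.
move=> locQ.
pose P (V : set (set X)) := (forall A, V A -> open A /\ exists2 U, Q U & A `<=` U)
  /\ (forall A B x, V A -> V B -> A x -> B x -> A = B).
have [F FP Ftot|V [[Vop Vdis] Vmax]] := @Zorn_bigcup _ P.
  split=> [A [S FS SA]|A B x [S FS SA] [S' FS' S'B]].
    exact: (FP _ FS).1.
  by case: (Ftot _ _ FS FS') => sub; [apply: (FP _ FS').2|apply: (FP _ FS).2] => //;
    exact: sub.
exists V; split=> //.
- by move=> A /Vop[].
- by move=> A /Vop[].
move=> O [x Ox] oO; apply: contrapT => ndisj.
have {}ndisj A y : V A -> A y -> O y -> False.
  by move=> VA Ay Oy; apply: ndisj; exists y; split => //; exists A.
have [U [oU Ux QU]] := locQ x.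
apply: (Vmax (V `|` [set O `&` U])).
  split=> [A VA|]; first by left.
  by move=> /(_ _ (or_intror erefl)) VOU; apply: (ndisj _ x VOU).
split=> [A [/Vop//|->]|A B y [VA|->] [VB|->]//].
- by split; [exact: openI|exists U => // ? []].
- exact: Vdis.
- by move=> Ay [Oy _]; case: (ndisj A y).
- by move=> [Oy _] By; case: (ndisj B y).
Qed.

(** * The alternative between a small cover and a large clopen discrete set *)

Theorem theorem4p4 (tau : Type) (X : topologicalType) :
  infinite_regular tau ->
  accessible_space X ->
  locally_openly_lindelof X tau ->
  odL_le X tau ->
  L_le X tau \/
  exists D : set X,
    [/\ clopen D, [set: tau] #<= D & discrete_subspace D].
Proof.
move=> tau_reg T1 loc [K [odK _] Ktau].
have od := covering_property_mono odK Ktau.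
pose Q := [set U : set X | open U /\ lindelof_in tau U].
have locQ x : exists U, [/\ open U, U x & Q U].
  have [U [oU Ux LU]] := loc x; exists U; split=> //; split=> //.
  exact: lindelof_in_subspace.
have [V [Vop VQ Vdis Vdense]] := maximal_disjoint_open_refinement locQ.
have oV : open (\bigcup_(A in V) A) by exact: bigcup_open.
have [|||x _|D0 [D0Q D0cov D0lt]] := lindelof_in_closed_nowhere_dense tau_reg od
    (F := ~` \bigcup_(A in V) A) _ _ (C := Q).
- by rewrite closedC.
- by rewrite setCK.
- by move=> U [].
- by have [U [_ Ux QU]] := locQ x; exists U.
pose W := \bigcup_(U in D0) U.
have oW : open W by apply: bigcup_open => U /D0Q[].
have WV x : ~ W x -> exists2 A, V A & A x.
  by move=> nWx; apply: contrapT => nVx; apply: nWx; exact: D0cov.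
pose bad (A : set X) (x : X) := [/\ A x, ~ W x & ~ open [set x]].
pose J := [set A | V A /\ exists x, bad A x].
have Jlt : card_lt J [set: tau].
  (* A nonempty [J] supplies the default point [x0] for the choice of [p]. *)
  have [->|/set0P[_ [_ [x0 _]]]] := eqVneq J set0.
    exact: card_lt_finite tau_reg.1.
  have /choice[p pP] : forall A, exists x, J A -> bad A x.
    move=> A; have [[_ [x Ax]]|nJA] := pselect (J A); first by exists x.
    by exists x0.
  have pV A B : J A -> V B -> B (p A) -> A = B.
    by move=> JA VB BpA; have [ApA _ _] := pP A JA; exact: Vdis JA.1 VB ApA BpA.
  pose S := p @` J.
  (* By disjointness [A] meets [S] at most in [p A], and points are closed. *)
  have oVS A : V A -> open (A `\` S).
    move=> VA; have [JA|nJA] := pselect (J A).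
      have -> : A `\` S = A `&` ~` [set p A].
        rewrite eqEsubset; split=> y [Ay nSy]; split=> //.
          by move=> ypA; apply: nSy; exists A.
        by move=> [B JB pBy]; apply: nSy; rewrite -pBy (pV B A)// pBy.
      by apply: openI; [exact: Vop|rewrite openC; exact: accessible_closed_set1].
    have -> : A `\` S = A; last exact: Vop.
    rewrite eqEsubset; split=> [y []//|y Ay]; split=> // -[B JB pBy].
    by apply: nJA; rewrite -(pV B A)// pBy.
  have cS : closed S.
    (* [S] misses [W], and the members of [V] cover all points outside [W]. *)
    rewrite -openC; have -> : ~` S = W `|` \bigcup_(A in V) (A `\` S).
      rewrite eqEsubset; split=> y => [nSy|[Wy|[A _ []//]] [A JA pAy]].
        have [Wy|/WV[A VA Ay]] := pselect (W y); first by left.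
        by right; exists A.
      by have [_ + _] := pP A JA; rewrite pAy.
    by apply: openU => //; exact: bigcup_open.
  (* A nonempty open [O] inside [S] would meet some [A] in [p A] alone and so isolate this bad
     point. *)
  have dS : dense (~` S).
    move=> O [y Oy] oO; apply: contrapT => nO.
    have OS z : O z -> S z.
      by move=> Oz; apply: contrapT => nSz; apply: nO; exists z.
    have [A JA pAy] := OS y Oy; have [ApA _ npA] := pP A JA; apply: npA.
    have -> : [set p A] = O `&` A.
      rewrite eqEsubset; split=> [_ ->|z [/OS[B JB <-] Az]]; first by split=> //; rewrite pAy.
      by rewrite (pV B A)//; exact: JA.1.
    by apply: openI => //; exact: Vop JA.1.
  (* [J] covers [S], and [p A] lies in no member of [J] but [A]; a small subcover is therefore all
     of [J]. *)
  have [|_ [A JA <-]|D [DJ SD Dlt]] :=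
    lindelof_in_closed_nowhere_dense tau_reg od cS dS (C := J).
  - by move=> A [/Vop].
  - by exists A => //; case: (pP A JA).
  apply: card_le_lt_trans Dlt; apply: subset_card_le => A JA.
  have [|B DB BpA] := SD (p A); first by exists A.
  by rewrite (pV A B)//; exact: (DJ B DB).1.
have /choice[u uP] : forall A, exists U, V A -> Q U /\ A `<=` U.
  move=> A; have [VA|nVA] := pselect (V A); last by exists set0.
  by have [U QU AU] := VQ A VA; exists U.
pose T := ~` (W `|` \bigcup_(A in J) u A).
(* A nonisolated point outside [W] is bad for its [A], which puts [A] in [J] and the point in
   [u A]. *)
have Tiso x : T x -> open [set x].
  move=> /not_orP[nWx nJx]; have [A VA Ax] := WV x nWx.
  apply: contrapT => nox; apply: nJx; exists A; last exact: (uP A VA).2.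
  by split => //; exists x.
have cT : closed T.
  rewrite closedC; apply: openU => //; apply: bigcup_open => A [VA _].
  by have [[]] := uP A VA.
have [Tge|/card_ltNge Tlt] := pselect ([set: tau] #<= T).
  right; exists T; split => //; last exact: discrete_subspace_isolated_points.
  by split => //; exact: open_isolated_points.
left; apply/L_leP.
(* As [T] is small, one neighborhood from [Q] for each of its points completes a small cover of
   [X]. *)
have /choice[v vP] : forall x, exists U, U x /\ Q U.
  by move=> x; have [U []] := locQ x; exists U.
have lindX : lindelof_in tau (\bigcup_(U in D0 `|` u @` J `|` v @` T) U).
  apply: lindelof_in_bigcup => //.
    apply: regular_setU => //; first apply: regular_setU => //.
    - exact: card_le_lt_trans (card_image_le _ _) Jlt.
    - exact: card_le_lt_trans (card_image_le _ _) Tlt.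
  move=> U [[/D0Q[]//|[A [VA _] <-]]|[x _ <-]].
  - by have [[]] := uP A VA.
  - by have [_ []] := vP x.
move=> C Cop Ccov; have [|D [DC Dcov Dlt]] := lindX C Cop.
  by move=> x _; rewrite -[X in X x]/(cover C id) Ccov.
exists D; split => //; rewrite /covers -subTset => x _; apply: Dcov.
have [[[U DU Ux]|[A JA ux]]|nx] := pselect ((W `|` \bigcup_(A in J) u A) x).
- by exists U => //; left; left.
- by exists (u A) => //; left; right; exists A.
- by exists (v x); [right; exists x|exact: (vP x).1].
Qed.
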